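(* Let $P=\{\sigma_c : c\in\mathbb{F}_q\}\le SL_2(\mathbb{F}_q)$, where $\sigma_c=\begin{pmatrix}1&c\\0&1\end{pmatrix}$. Then the set $\mathcal{B}=\{a_0,\Delta,\beta,\gamma_0\}$ generates the invariant ring $\mathbb{F}[V]^P$ as an $\mathbb{F}$-algebra; in fact $\mathcal{B}$ is a SAGBI basis for $\mathbb{F}[V]^P$ with respect to the graded reverse lexicographic order with $a_0<a_1<a_2$.
   Context: Let $p>2$ be a prime, $q=p^n$, and $\mathbb{F}$ a field of characteristic $p$ containing $\mathbb{F}_q$. Let $\mathbb{F}[V]=\mathbb{F}[a_0,a_1,a_2]$ (the symmetric algebra on the dual of the second symmetric power of the natural $2$-dimensional representation). The group $GL_2(\mathbb{F})$ acts on the right on $\mathbb{F}[a_0,a_1,a_2]$ by algebra automorphisms: for $g=\begin{pmatrix}\alpha&\beta'\\ \gamma'&\delta\end{pmatrix}$, $a_2 g=\alpha^2a_2+2\alpha\beta' a_1+\beta'^2a_0$, $a_1g=\alpha\gamma' a_2+(\alpha\delta+\beta'\gamma')a_1+\beta'\delta a_0$, $a_0g=\gamma'^2a_2+2\gamma'\delta a_1+\delta^2a_0$ (so $a_2,a_1,a_0$ transform like $u^2,uv,v^2$ under $u\mapsto \alpha u+\beta' v$, $v\mapsto\gamma' u+\delta v$). In particular $a_2\sigma_c=a_2+2ca_1+c^2a_0$, $a_1\sigma_c=a_1+ca_0$, $a_0\sigma_c=a_0$. For a subgroup $G$, $\mathbb{F}[V]^G$ denotes the ring of $G$-invariant polynomials.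 Define $\Delta=a_1^2-a_0a_2$, $\beta=\prod_{c\in\mathbb{F}_q}(a_1+ca_0)=a_1^q-a_0^{q-1}a_1$, and for $k\in\mathbb{F}_q$, $\gamma_k=\prod_{c\in\mathbb{F}_q}(a_2+2ca_1+(c^2-k)a_0)$. A SAGBI basis of a subalgebra $R$ of a polynomial ring (w.r.t. a monomial order) is a subset of $R$ whose lead monomials generate the algebra of lead monomials of elements of $R$. *)

(* Defs.v *)
From HB Require Import structures.
From mathcomp Require Import all_boot all_order all_algebra all_field.
From mathcomp Require Import mpoly.
Set Implicit Arguments. Unset Strict Implicit. Unset Printing Implicit Defensive.
Import GRing.Theory.
Local Open Scope ring_scope.

Definition i0 : 'I_3 := @Ordinal 3 0 isT.
Definition i1 : 'I_3 := @Ordinal 3 1 isT.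
Definition i2 : 'I_3 := @Ordinal 3 2 isT.

Section Defs.
Variable F : fieldType.

Definition a0 : {mpoly F[3]} := 'X_i0.
Definition a1 : {mpoly F[3]} := 'X_i1.
Definition a2 : {mpoly F[3]} := 'X_i2.

(* The algebra automorphism of F[a0,a1,a2] induced by sigma_c :
   a0 |-> a0, a1 |-> a1 + c a0, a2 |-> a2 + 2c a1 + c^2 a0.
   f \mPo sigma c  is  f sigma_c. *)
Definition sigma (c : F) : 3.-tuple {mpoly F[3]} :=
  [tuple a0; a1 + c *: a0; a2 + (2 * c) *: a1 + (c ^+ 2) *: a0].

Definition Delta : {mpoly F[3]} := a1 ^+ 2 - a0 * a2.

Section OverFq.
Variables (K : finFieldType) (iota : {rmorphism K -> F}).

Definition invariantP : pred {mpoly F[3]} :=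
  fun f => [forall c : K, f \mPo sigma (iota c) == f].

Definition beta : {mpoly F[3]} := \prod_(c : K) (a1 + iota c *: a0).

Definition gamma (k : F) : {mpoly F[3]} :=
  \prod_(c : K) (a2 + (2 * iota c) *: a1 + (iota c ^+ 2 - k) *: a0).

End OverFq.
End Defs.

(* Graded reverse lexicographic order with a0 < a1 < ... (variable i is
   'X_i): m < m' iff deg m < deg m', or equal degrees and at the first index
   i (starting from the smallest variable, index 0) where they differ,
   m i > m' i. *)
Definition grevlex_lt (n : nat) (m m' : 'X_{1..n}) : bool :=
  (mdeg m < mdeg m')%N ||
  ((mdeg m == mdeg m') &&
   [exists i : 'I_n, ((m' i < m i)%N &&
      [forall j : 'I_n, (j < i)%N ==> (m j == m' j)])]).

Definition grevlex_lead (F : fieldType) (n : nat) (f : {mpoly F[n]})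
  (m : 'X_{1..n}) : Prop :=
  m \in msupp f /\ forall m', m' \in msupp f -> m' = m \/ grevlex_lt m' m.

Definition grevlex_SAGBI (F : fieldType) (n k : nat)
  (R : pred {mpoly F[n]}) (B : 'I_k -> {mpoly F[n]}) : Prop :=
  (forall i, B i \in R) /\
  forall f, f \in R -> f != 0 -> forall m, grevlex_lead f m ->
    exists lm : 'I_k -> 'X_{1..n}, exists e : 'I_k -> nat,
      (forall i, grevlex_lead (B i) (lm i)) /\
      (forall j : 'I_n, m j = \sum_(i < k) e i * lm i j)%N.

(* Main.v *)
Require Import Defs.
From HB Require Import structures.
From mathcomp Require Import all_boot all_order all_algebra all_field.
From mathcomp Require Import mpoly.
From mathcomp Require Import zify ring.
Import GRing.Theory.
Local Open Scope ring_scope.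
Set Implicit Arguments. Unset Strict Implicit. Unset Printing Implicit Defensive.

(* Let A = F[a0, Delta, beta, gamma_0]. The lead monomials of the generators
   are a0, a1^2, a1^q and a2^q.  Since a0 (a2 + 2c a1 + c^2 a0) =
   (a1 + c a0)^2 - Delta, the product a0^q gamma_0 is a polynomial in a0,
   Delta and beta^2 in which beta^2 has coefficient 1; this relation rewrites
   every element of A as a combination of the products
   a0^i Delta^j beta^e gamma_0^k with e <= 1.  As q is odd, these products have
   pairwise distinct lead monomials.  Hence the generators are a SAGBI basis
   of A, and a0 f in A implies f in A: the part of a0 f free of a0 would have
   a lead monomial prime to a0.
   It remains to see that a power of a0 multiplies an invariant f, homogeneous
   of degree d, into A.  Put P(T) = f(s^2, s T, T^2 - D) in F[s, D][T].
   Then P(T + c s) = P(T) for c in F_q, so P is a polynomial in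
   T^q - s^(q-1) T; at s = a0, D = Delta, T = a1 it takes the value a0^d f,
   while T^q - s^(q-1) T becomes beta. *)

(** * The grevlex order on monomials in three variables *)

Lemma ord3P (P : 'I_3 -> Prop) : P i0 -> P i1 -> P i2 -> forall i, P i.
Proof.
move=> P0 P1 P2 [[|[|[|//]]] lti].
- by rewrite (_ : Ordinal lti = i0) //; apply: val_inj.
- by rewrite (_ : Ordinal lti = i1) //; apply: val_inj.
- by rewrite (_ : Ordinal lti = i2) //; apply: val_inj.
Qed.

Lemma big_ord3 (R : Type) (idx : R) (op : Monoid.law idx) (G : 'I_3 -> R) :
  \big[op/idx]_(i < 3) G i = op (G i0) (op (G i1) (G i2)).
Proof.
rewrite !big_ord_recl big_ord0 Monoid.mulm1.
by congr (op _ (op _ _)); congr G; apply: val_inj.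
Qed.

Lemma mnm3P (m m' : 'X_{1..3}) :
  m i0 = m' i0 -> m i1 = m' i1 -> m i2 = m' i2 -> m = m'.
Proof. by move=> e0 e1 e2; apply/mnmP; apply: ord3P. Qed.

Lemma mdeg3 (m : 'X_{1..3}) : mdeg m = (m i0 + (m i1 + m i2))%N.
Proof. by rewrite mdegE big_ord3. Qed.

Lemma grevlex3E (m m' : 'X_{1..3}) : grevlex_lt m m' =
  (mdeg m < mdeg m')%N || ((mdeg m == mdeg m') &&
   ((m' i0 < m i0)%N || ((m i0 == m' i0) && (m' i1 < m i1)%N))).
Proof.
rewrite /grevlex_lt; case: ltnP => //= _; case: eqP => //= dE.
apply/existsP/idP => [[i /andP[]]|].
  elim/ord3P: i => [-> //| lt1 /forallP /(_ i0)|lt2 /forallP e].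
    by rewrite /= => ->; rewrite lt1 orbT.
  have := e i0; have := e i1; rewrite /= => /eqP e1 /eqP e0.
  by move: dE lt2; rewrite !mdeg3 e0 e1 => /addnI/addnI->; rewrite ltnn.
case/orP => [lt0|/andP[e0 lt1]]; [exists i0|exists i1]; rewrite ?lt0 ?lt1 /=.
  by apply/forallP.
by apply/forallP; apply: ord3P; rewrite // e0.
Qed.

Lemma grevlex_lt_irr (m : 'X_{1..3}) : ~~ grevlex_lt m m.
Proof. by rewrite grevlex3E; lia. Qed.

Lemma grevlex_lt_trans (m1 m2 m3 : 'X_{1..3}) :
  grevlex_lt m1 m2 -> grevlex_lt m2 m3 -> grevlex_lt m1 m3.
Proof. by rewrite !grevlex3E; lia. Qed.

Lemma grevlex_lt_total (m m' : 'X_{1..3}) :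
  m != m' -> ~~ grevlex_lt m m' -> grevlex_lt m' m.
Proof.
move=> /eqP ne; rewrite !grevlex3E => H.
have: ~ (m i0 = m' i0 /\ m i1 = m' i1 /\ m i2 = m' i2).
  by case=> e0 [e1 e2]; apply: ne; apply: mnm3P.
by move: H; rewrite !mdeg3; lia.
Qed.

Lemma grevlex_ltDr (k m m' : 'X_{1..3}) :
  grevlex_lt (m + k)%MM (m' + k)%MM = grevlex_lt m m'.
Proof. by rewrite !grevlex3E !mdegD !mnmDE; lia. Qed.

(** * Lead monomials with coefficient one, and their products *)

Section Lead.
Variable F : fieldType.
Implicit Types (f g : {mpoly F[3]}) (m : 'X_{1..3}).

Definition supp_lt m f := forall m', m' \in msupp f -> grevlex_lt m' m.

(** Fixing the lead coefficient to be 1 makes this closed under products, and the error term [f -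
    'X_[m]] may be 0. *)
Definition monic_lead f m := supp_lt m (f - 'X_[m]).

Lemma supp_lt0 m : supp_lt m 0.
Proof. by move=> m'; rewrite msupp0. Qed.

Lemma supp_ltD m f g : supp_lt m f -> supp_lt m g -> supp_lt m (f + g).
Proof.
by move=> hf hg m' /msuppD_le; rewrite mem_cat => /orP[/hf|/hg].
Qed.

Lemma supp_ltZ m c f : supp_lt m f -> supp_lt m (c *: f).
Proof. by move=> hf m' /msuppZ_le /hf. Qed.

Lemma supp_ltX m m' : grevlex_lt m' m -> supp_lt m 'X_[m'].
Proof. by move=> lt k /mem_msuppXP <-. Qed.

Lemma supp_lt_sum (I : eqType) (r : seq I) (P : pred I)
    (G : I -> {mpoly F[3]}) m :
  (forall i, i \in r -> P i -> supp_lt m (G i)) ->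
  supp_lt m (\sum_(i <- r | P i) G i).
Proof.
move=> H; rewrite big_seq_cond.
by elim/big_ind: _ => [||i /andP[]];
  [exact: supp_lt0 | move=> ? ?; exact: supp_ltD | exact: H].
Qed.

Lemma supp_ltM m m' f g : supp_lt m f ->
  (forall k, k \in msupp g -> k = m' \/ grevlex_lt k m') ->
  supp_lt (m + m')%MM (f * g).
Proof.
move=> hf hg k /msuppM_le /allpairsP[[u v] /= [/hf ltu /hg gv ->]].
have ltum : grevlex_lt (u + v)%MM (m + v)%MM by rewrite grevlex_ltDr.
case: gv => [<- //|ltv]; apply: grevlex_lt_trans ltum _.
by rewrite ![(m + _)%MM]addmC grevlex_ltDr.
Qed.

Lemma monic_lead_le f m k :
  monic_lead f m -> k \in msupp f -> k = m \/ grevlex_lt k m.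
Proof.
move=> lf; rewrite -[f](subrK 'X_[m]) => /msuppD_le.
by rewrite mem_cat => /orP[/lf|/mem_msuppXP ->]; [right|left].
Qed.

Lemma supp_lt_coeff0 f m : supp_lt m f -> f@_m = 0.
Proof.
move=> hf; apply/eqP; rewrite mcoeff_eq0; apply/negP => /hf.
exact/negP/grevlex_lt_irr.
Qed.

Lemma monic_lead_coeff f m : monic_lead f m -> f@_m = 1.
Proof.
move/supp_lt_coeff0/eqP; rewrite mcoeffB mcoeffX eqxx subr_eq0.
by move/eqP.
Qed.

Lemma monic_lead_grevlex f m : monic_lead f m -> grevlex_lead f m.
Proof.
move=> lf; split=> [|k]; last exact: monic_lead_le.
by rewrite mcoeff_msupp (monic_lead_coeff lf) oner_eq0.
Qed.

Lemma monic_lead_supp_lt f m m' :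
  monic_lead f m -> grevlex_lt m m' -> supp_lt m' f.
Proof.
by move=> lf lt k /(monic_lead_le lf)[-> //|/grevlex_lt_trans]; apply.
Qed.

Lemma monic_leadX m : monic_lead 'X_[m] m.
Proof. by rewrite /monic_lead subrr; exact: supp_lt0. Qed.

Lemma monic_leadD f g m : monic_lead f m -> supp_lt m g -> monic_lead (f + g) m.
Proof. by move=> lf lg; rewrite /monic_lead addrAC; exact: supp_ltD. Qed.

Lemma monic_leadM f g m m' :
  monic_lead f m -> monic_lead g m' -> monic_lead (f * g) (m + m')%MM.
Proof.
move=> lf lg; rewrite /monic_lead mpolyXD.
(* Each summand of the error has one factor that is strictly below its lead monomial. *)
have -> : f * g - 'X_[m] * 'X_[m'] =
    (f - 'X_[m]) * g + (g - 'X_[m']) * 'X_[m] by ring.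
apply: supp_ltD; first by apply: supp_ltM => // k; exact: monic_lead_le.
by rewrite addmC; apply: supp_ltM => // k /mem_msuppXP ->; left.
Qed.

Lemma monic_lead_prod (I : Type) (r : seq I) (P : pred I)
    (G : I -> {mpoly F[3]}) (m : I -> 'X_{1..3}) :
  (forall i, P i -> monic_lead (G i) (m i)) ->
  monic_lead (\prod_(i <- r | P i) G i) (\sum_(i <- r | P i) m i)%MM.
Proof.
move=> H; elim/big_rec2: _ => [|i g f Pi]; last exact/monic_leadM/H.
by rewrite -mpolyX0; exact: monic_leadX.
Qed.

Lemma monic_lead_exp f m k : monic_lead f m -> monic_lead (f ^+ k) (m *+ k)%MM.
Proof.
move=> lf; elim: k => [|k IH]; first by rewrite expr0 -mpolyX0; exact: monic_leadX.
by rewrite exprS mulmS; exact: monic_leadM.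
Qed.

Lemma grevlex_lead_uniq f m m' :
  grevlex_lead f m -> grevlex_lead f m' -> m = m'.
Proof.
move=> [mf lm] [m'f lm']; case: (lm m' m'f) => // lt1.
case: (lm' m mf) => // lt2.
by have := grevlex_lt_irr m; rewrite (grevlex_lt_trans lt2 lt1).
Qed.

(** Injectivity makes the maximum strict, so in a linear combination of terms with lead monomials
    [lam t] nothing can cancel the top one. *)
Lemma exists_grevlex_max (T : eqType) (lam : T -> 'X_{1..3}) (s : seq T) :
  s != [::] -> {in s &, injective lam} ->
  exists2 t, t \in s & {in s, forall u, u != t -> grevlex_lt (lam u) (lam t)}.
Proof.
elim: s => // x s IH _ inj; have [-> {IH inj}|s0] := eqVneq s [::].
  by exists x; rewrite ?mem_head // => u; rewrite inE => ->.
have [u v us vs|t ts max_t] := IH s0.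
  by apply: inj; rewrite inE (us, vs) ?us ?vs orbT.
have [->|ne] := eqVneq x t.
  exists t; rewrite ?mem_head // => u; rewrite inE => /orP[->//|].
  exact: max_t.
have [lt|/grevlex_lt_total nlt] := boolP (grevlex_lt (lam x) (lam t)).
  exists t; first by rewrite inE ts orbT.
  by move=> u; rewrite inE => /orP[/eqP-> //|]; exact: max_t.
have {nlt} lt : grevlex_lt (lam t) (lam x).
  apply: nlt; apply: contra_neq ne; apply: inj; rewrite ?mem_head //.
  by rewrite inE ts orbT.
exists x; first exact: mem_head.
move=> u; rewrite inE => /orP[-> //|us _].
by have [-> //|] := eqVneq u t; move/(max_t _ us)/grevlex_lt_trans; apply.
Qed.

End Lead.

(** * Polynomials invariant under translations *)

Section Artin.
Variables (K : finFieldType) (C : idomainType) (phi : {rmorphism K -> C}).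
Variable S : C.
Hypothesis S0 : S != 0.
Let q := #|K|.

(** The homogenised Artin-Schreier polynomial; its roots are the multiples of [S] by elements of
    [K]. *)
Definition additive_poly : {poly C} := 'X^q - S ^+ q.-1 *: 'X.

Let q_gt1 : (1 < q)%N. Proof. exact: finNzRing_gt1. Qed.
Let qE : q = q.-1.+1. Proof. by rewrite prednK // ltnW. Qed.

Lemma size_additive_poly : size additive_poly = q.+1.
Proof.
rewrite size_polyDl size_polyXn // size_polyN.
by rewrite (leq_ltn_trans (size_scale_leq _ _)) // size_polyX ltnS.
Qed.

Lemma additive_poly_monic : additive_poly \is monic.
Proof.
rewrite monicE lead_coefE size_additive_poly /= coefB coefXn eqxx coefZ coefX.
by rewrite gtn_eqF // mulr0 subr0.
Qed.

Let exprq (x : C) : x ^+ q = x * x ^+ q.-1.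
Proof. by rewrite -exprS -qE. Qed.

Let rts := [seq phi c * S | c <- enum K].

Let uniq_rts : uniq rts.
Proof.
rewrite map_inj_uniq ?enum_uniq // => c d /(mulIf S0).
exact: fmorph_inj.
Qed.

Let size_rts : size rts = q. Proof. by rewrite size_map -cardE. Qed.

Lemma horner_additive_poly T : additive_poly.[T] = T ^+ q - S ^+ q.-1 * T.
Proof. by rewrite !hornerE. Qed.

Lemma additive_poly_root c : additive_poly.[phi c * S] = 0.
Proof.
by rewrite horner_additive_poly exprMn -rmorphXn expf_card exprq; ring.
Qed.

(** The points [phi c * S] are [q] distinct elements, because [S != 0] and [phi] is injective. *)
Lemma poly_eq0_of_roots (r : {poly C}) :
  (size r <= q)%N -> (forall c, r.[phi c * S] = 0) -> r = 0.
Proof.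
move=> szr rr; apply/eqP/negPn/negP => r0.
suff: (size rts < size r)%N by rewrite size_rts ltnNge szr.
apply: max_poly_roots => //; by apply/allP => _ /mapP[c _ ->]; apply/eqP.
Qed.

(** As polynomials in [T], both sides are monic of degree [q] and vanish at all [phi c * S]; their
    difference has degree below [q] and [q] roots. *)
Lemma prod_translates T :
  \prod_(c : K) (T + phi c * S) = T ^+ q - S ^+ q.-1 * T.
Proof.
rewrite -horner_additive_poly.
(* The sign on [c] turns each translate into a factor ['X] minus a root. *)
suff -> : additive_poly = \prod_(c : K) ('X - (phi (- c) * S)%:P).
  rewrite horner_prod; apply: eq_bigr => c _.
  by rewrite hornerXsubC rmorphN mulNr opprK.
set p2 := \prod_(c : K) _.
have p2E : p2 = \prod_(x <- [seq phi (- c) * S | c : K]) ('X - x%:P).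
  by rewrite big_image.
have sz2 : size p2 = q.+1 by rewrite p2E size_prod_XsubC size_image.
have mon2 : p2 \is monic by rewrite p2E monic_prod_XsubC.
apply/eqP; rewrite -subr_eq0; apply/eqP/poly_eq0_of_roots.
  apply/leq_sizeP => j; rewrite leq_eqVlt coefB => /orP[/eqP <-|ltj].
    move: additive_poly_monic mon2.
    by rewrite !monicE !lead_coefE sz2 size_additive_poly => /eqP-> /eqP->; rewrite subrr.
  by rewrite !nth_default ?subrr // ?sz2 ?size_additive_poly.
move=> c; rewrite hornerD hornerN additive_poly_root sub0r.
rewrite horner_prod (bigD1 (- c)) //= hornerXsubC opprK subrr mul0r.
by rewrite oppr0.
Qed.

Hypothesis pcharq : [pchar C].-nat q.

(** [q] is a power of the characteristic, so the [q]-th power is additive, and [phi c * S] is a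
    root. *)
Lemma additive_poly_translate c :
  additive_poly \Po ('X + (phi c * S)%:P) = additive_poly.
Proof.
have pcharP : [pchar {poly C}].-nat q.
  by apply: sub_in_pnat pcharq => p _; exact: (rmorph_pchar polyC).
rewrite {1}/additive_poly rmorphB /= comp_polyZ comp_polyX rmorphXn /= comp_polyX.
rewrite exprDn_pchar // -polyC_exp /additive_poly.
rewrite exprMn -rmorphXn expf_card exprq.
by rewrite scalerDr -!mul_polyC -polyCM mulrCA mulrA; ring.
Qed.

(** Induction on the size. Invariance gives [P] the value [P.[0]] at every root of [additive_poly],
    which therefore divides [P - P.[0]%:P]; the quotient is smaller and again invariant. *)
Lemma translation_invariant_poly (P : {poly C}) :
  (forall c, P \Po ('X + (phi c * S)%:P) = P) ->
  exists Q : {poly C}, P = Q \Po additive_poly.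
Proof.
have [k] := ubnP (size P); elim: k => // k IH in P *; rewrite ltnS => szP invP.
have := Pdiv.RingMonic.rdivp_eq additive_poly_monic (P - P.[0]%:P).
set D := Pdiv.CommonRing.rdivp _ _; set r := Pdiv.CommonRing.rmodp _ _ => PE.
have r0 : r = 0.
  apply: poly_eq0_of_roots.
    rewrite -ltnS -size_additive_poly Pdiv.Ring.ltn_rmodp.
    exact/monic_neq0/additive_poly_monic.
  move=> c; have /eqP := congr1 (horner^~ (phi c * S)) PE.
  rewrite hornerD hornerN hornerC hornerD hornerM additive_poly_root mulr0 add0r.
  have /(congr1 (horner^~ 0)) := invP c.
  rewrite horner_comp hornerD hornerX hornerC add0r => ->.
  by rewrite subrr => /eqP.
have {r PE r0} PE : P = P.[0]%:P + D * additive_poly.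
  by rewrite -[LHS](subrK P.[0]%:P) PE r0 addr0 addrC.
have [D0|Dn0] := eqVneq D 0.
  by exists P.[0]%:P; rewrite comp_polyC {1}PE D0 mul0r addr0.
have szD : (size D < size P)%N.
  have := congr1 (fun p : {poly C} => size (p - P.[0]%:P)) PE.
  rewrite [P.[0]%:P + _]addrC addrK size_Mmonic ?additive_poly_monic //.
  rewrite size_additive_poly addnS /= => sE.
  have : (size D + q <= maxn (size P) 1)%N.
    rewrite -sE (leq_trans (size_polyD _ _)) // size_polyN geq_max leq_maxl /=.
    by rewrite leq_max size_polyC_leq1 orbT.
  have : (0 < size D)%N by rewrite lt0n size_poly_eq0.
  by have := q_gt1; rewrite /q; move: (size P) (size D) #|K| => a b c; lia.
have [||Q DE] := IH D; first exact: leq_trans szD _.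
  (* The constant is generalised first, so that rewriting [P] leaves it alone. Cancelling it and the
     invariant factor [additive_poly] gives the invariance of [D]. *)
  move=> c; have := invP c; move: (P.[0]) PE => a ->.
  rewrite comp_polyD comp_polyM comp_polyC.
  rewrite additive_poly_translate => /addrI.
  exact/mulIf/monic_neq0/additive_poly_monic.
exists (P.[0]%:P + Q * 'X).
by rewrite comp_polyD comp_polyM comp_polyC comp_polyX -DE.
Qed.

End Artin.

(* The identity is proved for D = X^2, where the left-hand side is a product
   over translates of T - X times one over translates of T + X; composition
   with X^2 is injective. *)
Lemma prod_sqr_translates (K : finFieldType) (C : idomainType)
    (phi : {rmorphism K -> C}) (S T D : C) :
  S != 0 -> [pchar C].-nat #|K| -> odd #|K| ->
  \prod_(c : K) ((T + phi c * S) ^+ 2 - D) =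
  (T ^+ #|K| - S ^+ #|K|.-1 * T) ^+ 2 - D ^+ #|K|
    + 2 * S ^+ #|K|.-1 * D ^+ (#|K|./2).+1 - S ^+ (#|K|.-1).*2 * D.
Proof.
move=> S0 pcharq oddq; set q := #|K|.
pose L : {poly C} := \prod_(c : K) (((T + phi c * S) ^+ 2)%:P - 'X).
pose R : {poly C} := ((T ^+ q - S ^+ q.-1 * T) ^+ 2)%:P - 'X ^+ q
  + (2 * S ^+ q.-1)%:P * 'X ^+ (q./2).+1 - (S ^+ (q.-1).*2)%:P * 'X.
suff /(congr1 (horner^~ D)) : L = R.
  rewrite horner_prod /R !hornerE => <-; apply: eq_bigr => c _.
  by rewrite !hornerE.
apply/eqP; rewrite -subr_eq0 -(@comp_poly_eq0 _ _ 'X^2) ?size_polyXn //.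
rewrite rmorphB /= subr_eq0; apply/eqP.
have q_gt0 : (0 < q)%N by apply/card_gt0P; exists 0.
have qE : q = (q./2).*2.+1 by rewrite -{1}[q]odd_double_half oddq.
have pcharP : [pchar {poly C}].-nat q.
  by apply: sub_in_pnat pcharq => p _; exact: (rmorph_pchar polyC).
pose phiX : {rmorphism K -> {poly C}} := polyC \o phi.
have SX0 : S%:P != 0 by rewrite polyC_eq0.
have -> : L \Po 'X^2 = (\prod_(c : K) (T%:P - 'X + phiX c * S%:P)) *
                       (\prod_(c : K) (T%:P + 'X + phiX c * S%:P)).
  rewrite rmorph_prod -big_split /=; apply: eq_bigr => c _.
  rewrite rmorphB /= comp_polyC comp_polyX polyC_exp polyCD polyCM.
  by rewrite /phiX /=; ring.
rewrite !prod_translates // -/q !exprDn_pchar // exprNn -signr_odd oddq /R.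
rewrite !rmorphD !rmorphN !rmorphM /= !comp_polyC !rmorphXn /= !comp_polyX.
rewrite !polyCB !polyCM !rmorphXn /= polyC_natr -muln2 exprM.
have -> : 'X^2 ^+ q = 'X^q ^+ 2 :> {poly C} by rewrite -!exprM mulnC.
(* Since [q] is odd, twice [(q./2).+1] is [q + 1]. *)
have -> : 'X^2 ^+ (q./2).+1 = 'X^q * 'X :> {poly C}.
  by rewrite -exprM [X in 'X^X * _]qE -exprSr; congr ('X^_); lia.
by ring.
Qed.

(** * Normal forms and lead monomials *)

Definition k0 : 'I_4 := @Ordinal 4 0 isT.
Definition k1 : 'I_4 := @Ordinal 4 1 isT.
Definition k2 : 'I_4 := @Ordinal 4 2 isT.
Definition k3 : 'I_4 := @Ordinal 4 3 isT.

Lemma ord4P (P : 'I_4 -> Prop) : P k0 -> P k1 -> P k2 -> P k3 -> forall i, P i.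
Proof.
move=> P0 P1 P2 P3 [[|[|[|[|//]]]] lti].
- by rewrite (_ : Ordinal lti = k0) //; apply: val_inj.
- by rewrite (_ : Ordinal lti = k1) //; apply: val_inj.
- by rewrite (_ : Ordinal lti = k2) //; apply: val_inj.
- by rewrite (_ : Ordinal lti = k3) //; apply: val_inj.
Qed.

Lemma big_ord4 (R : Type) (idx : R) (op : Monoid.law idx) (G : 'I_4 -> R) :
  \big[op/idx]_(i < 4) G i = op (G k0) (op (G k1) (op (G k2) (G k3))).
Proof.
rewrite !big_ord_recl big_ord0 Monoid.mulm1.
by congr (op _ (op _ (op _ _))); congr G; apply: val_inj.
Qed.

Section GeneratorLeads.
Variable q : nat.

Definition gens_lead (i : 'I_4) : 'X_{1..3} :=
  nth 0%MM [:: U_(i0); U_(i1) *+ 2; U_(i1) *+ q; U_(i2) *+ q]%MM i.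

Definition mon_lead (m : 'X_{1..4}) : 'X_{1..3} :=
  (\sum_(i < 4) gens_lead i *+ m i)%MM.

Lemma mon_leadE m j : mon_lead m j = (\sum_(i < 4) m i * gens_lead i j)%N.
Proof.
by rewrite mnm_sumE; apply: eq_bigr => i _; rewrite mulmnE mulnC.
Qed.

Lemma mon_lead0 m : mon_lead m i0 = m k0.
Proof.
by rewrite mon_leadE big_ord4 /gens_lead /= !mulmnE !mnm1E /=; lia.
Qed.

Lemma mon_lead1 m : mon_lead m i1 = (2 * m k1 + q * m k2)%N.
Proof.
by rewrite mon_leadE big_ord4 /gens_lead /= !mulmnE !mnm1E /=; lia.
Qed.

Lemma mon_lead2 m : mon_lead m i2 = (q * m k3)%N.
Proof.
by rewrite mon_leadE big_ord4 /gens_lead /= !mulmnE !mnm1E /=; lia.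
Qed.

(** The exponent of [a1] is [2 * m k1 + q * m k2]; as [q] is odd, its parity determines [m k2], and
    then [m k1] follows. *)
Lemma mon_lead_inj (m m' : 'X_{1..4}) : odd q -> (m k2 <= 1)%N -> (m' k2 <= 1)%N ->
  mon_lead m = mon_lead m' -> m = m'.
Proof.
move=> oddq r r' e.
have q_gt0 : (0 < q)%N by case: q oddq.
have e0 : m k0 = m' k0 by rewrite -!mon_lead0 e.
have e1 : (2 * m k1 + q * m k2 = 2 * m' k1 + q * m' k2)%N by rewrite -!mon_lead1 e.
have e3 : m k3 = m' k3.
  by apply/eqP; rewrite -(eqn_pmul2l q_gt0) -!mon_lead2 e.
have [e1' e2] : m k1 = m' k1 /\ m k2 = m' k2.
  by move: r r' e1 oddq; case: (m k2) => [|[|]] //; case: (m' k2) => [|[|]] //; lia.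
by apply/mnmP; apply: ord4P.
Qed.

End GeneratorLeads.

(** * The algebra spanned by products of the generators, and its normal forms *)

Section Generators.
Variables (F : fieldType) (K : finFieldType) (iota : {rmorphism K -> F}).
Let q := #|K|.

Let Cst : {rmorphism K -> {mpoly F[3]}} := @mpolyC 3 F \o iota.

Lemma a0_neq0 : a0 F != 0.
Proof. by rewrite -msupp_eq0 msuppX. Qed.

Lemma betaE : beta iota = a1 F ^+ q - a0 F ^+ q.-1 * a1 F.
Proof.
rewrite -(prod_translates Cst a0_neq0).
by apply: eq_bigr => c _; rewrite mul_mpolyC.
Qed.

Definition gens : 4.-tuple {mpoly F[3]} :=
  [tuple a0 F; Delta F; beta iota; gamma iota 0].

Lemma monic_lead_gens i : monic_lead (tnth gens i) (gens_lead q i).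
Proof.
(* [beta] and [gamma] are products over [K] of linear forms with lead monomials [a1] and [a2]; the
   multiple by [q] is put in the matching shape. *)
have sumq (m : 'X_{1..3}) : (m *+ q)%MM = (\sum_(c : K) m)%MM.
  apply/mnmP => j; rewrite mulmnE mnm_sumE sum_nat_const mulnC.
  by congr (_ * _)%N; apply: eq_card.
move: i; apply: ord4P; rewrite /gens_lead /tnth /=.
- exact: monic_leadX.
- apply: monic_leadD; first exact/monic_lead_exp/monic_leadX.
  rewrite -scaleN1r /a0 /a2 -mpolyXD; apply/supp_ltZ/supp_ltX.
  by rewrite grevlex3E !mdegD !mdeg1 !mulmnE !mnmDE !mnm1E.
- rewrite sumq; apply: monic_lead_prod => c _.
  apply: monic_leadD; first exact: monic_leadX.
  by apply/supp_ltZ/supp_ltX; rewrite grevlex3E !mdeg1 !mnm1E.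
- rewrite sumq; apply: monic_lead_prod => c _.
  apply: monic_leadD; last first.
    by apply/supp_ltZ/supp_ltX; rewrite grevlex3E !mdeg1 !mnm1E.
  apply: monic_leadD; first exact: monic_leadX.
  by apply/supp_ltZ/supp_ltX; rewrite grevlex3E !mdeg1 !mnm1E.
Qed.

Lemma monic_lead_mon m : monic_lead ('X_[m] \mPo gens) (mon_lead q m).
Proof.
rewrite comp_mpolyX; apply: monic_lead_prod => i _.
exact/monic_lead_exp/monic_lead_gens.
Qed.

(** The index [k2] belongs to [beta]: these are the normal forms for rewriting [beta ^+ 2]. *)
Definition reduced (Q : {mpoly F[4]}) := forall m, m \in msupp Q -> (m k2 <= 1)%N.

Hypothesis oddq : odd q.

(** By [mon_lead_inj] the terms have distinct lead monomials, so the largest one survives in the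
    sum. *)
Lemma reduced_lead (Q : {mpoly F[4]}) : reduced Q -> Q != 0 ->
  exists2 m, m \in msupp Q & grevlex_lead (Q \mPo gens) (mon_lead q m).
Proof.
move=> redQ Q0.
have [||m mQ max_m] := @exists_grevlex_max _ (mon_lead q) (msupp Q).
- by rewrite msupp_eq0.
- by move=> m m' /redQ r /redQ r'; exact: mon_lead_inj.
exists m => //; rewrite comp_mpolyEX (bigD1_seq m) ?msupp_uniq //=.
set rest := \sum_(i <- _ | _) _.
have lrest : supp_lt (mon_lead q m) rest.
  apply: supp_lt_sum => m' m'Q ne; apply: supp_ltZ.
  by apply: monic_lead_supp_lt (max_m _ m'Q ne); exact: monic_lead_mon.
have lm := @monic_lead_mon m; split=> [|k].
  rewrite mcoeff_msupp mcoeffD mcoeffZ (monic_lead_coeff lm) mulr1.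
  by rewrite (supp_lt_coeff0 lrest) addr0 -mcoeff_msupp.
move=> /msuppD_le; rewrite mem_cat => /orP[/msuppZ_le|/lrest]; last by right.
exact: monic_lead_le.
Qed.

Definition in_gens_alg (f : {mpoly F[3]}) := exists Q, f = Q \mPo gens.

Lemma reducedD Q R : reduced Q -> reduced R -> reduced (Q + R).
Proof.
by move=> rQ rR m /msuppD_le; rewrite mem_cat => /orP[/rQ|/rR].
Qed.

Lemma reducedZ c Q : reduced Q -> reduced (c *: Q).
Proof. by move=> rQ m /msuppZ_le /rQ. Qed.

Definition reducible f := exists2 Q, reduced Q & f = Q \mPo gens.

Lemma reducibleD f g : reducible f -> reducible g -> reducible (f + g).
Proof.
move=> [Q rQ ->] [R rR ->]; exists (Q + R); first exact: reducedD.
by rewrite rmorphD.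
Qed.

Lemma reducibleZ c f : reducible f -> reducible (c *: f).
Proof.
by move=> [Q rQ ->]; exists (c *: Q); [exact: reducedZ | rewrite linearZ].
Qed.

Hypothesis pcharq : [pchar F].-nat q.

Let pcharqM : [pchar {mpoly F[3]}].-nat q.
Proof. by apply: sub_in_pnat pcharq => p _; exact: (rmorph_pchar (@mpolyC 3 F)). Qed.

Lemma gamma_relation : a0 F ^+ q * gamma iota 0 =
  beta iota ^+ 2 - Delta F ^+ q
    + 2 * a0 F ^+ q.-1 * Delta F ^+ (q./2).+1 - a0 F ^+ (q.-1).*2 * Delta F.
Proof.
rewrite betaE -(prod_sqr_translates Cst _ _ a0_neq0) //.
(* One of the [q] factors [a0] goes to each factor of [gamma], which completes the square up to
   [Delta]. *)
rewrite -prodr_const -big_split /=; apply: eq_bigr => c _.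
rewrite subr0 /Delta -!mul_mpolyC mpolyCM !rmorphXn /= mpolyC_nat.
by ring.
Qed.

(** Strong induction on the exponent [l] of [beta]: replacing [beta ^+ 2] lowers it by two, while
    the other exponents may grow freely. *)
Lemma reducible_mon i j l k :
  reducible (a0 F ^+ i * (Delta F ^+ j * (beta iota ^+ l * gamma iota 0 ^+ k))).
Proof.
have [l'] := ubnP l; elim: l' => // l' IH in i j l k *.
case: l => [|[|l]] ltl.
1,2: set l := (l in beta iota ^+ l).
1,2: pose m : 'X_{1..4} := [multinom nth 0%N [:: i; j; l; k] x | x < 4].
1,2: exists 'X_[m]; [by move=> ? /mem_msuppXP <-; rewrite mnmE |].
1,2: by rewrite comp_mpolyX big_ord4 /= !mnmE.
have -> : beta iota ^+ l.+2 = beta iota ^+ l * (a0 F ^+ q * gamma iota 0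
  + Delta F ^+ q - 2 * a0 F ^+ q.-1 * Delta F ^+ (q./2).+1
  + a0 F ^+ (q.-1).*2 * Delta F).
  by rewrite gamma_relation -[l.+2]addn2 exprD; ring.
have -> : a0 F ^+ i * (Delta F ^+ j * (beta iota ^+ l * (a0 F ^+ q * gamma iota 0
  + Delta F ^+ q - 2 * a0 F ^+ q.-1 * Delta F ^+ (q./2).+1
  + a0 F ^+ (q.-1).*2 * Delta F) * gamma iota 0 ^+ k)) =
  a0 F ^+ (i + q) * (Delta F ^+ j * (beta iota ^+ l * gamma iota 0 ^+ k.+1))
  + a0 F ^+ i * (Delta F ^+ (j + q) * (beta iota ^+ l * gamma iota 0 ^+ k))
  + (- 2) *: (a0 F ^+ (i + q.-1) * (Delta F ^+ (j + (q./2).+1) *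
      (beta iota ^+ l * gamma iota 0 ^+ k)))
  + a0 F ^+ (i + (q.-1).*2) * (Delta F ^+ j.+1 *
      (beta iota ^+ l * gamma iota 0 ^+ k)).
  rewrite -mul_mpolyC rmorphN /= mpolyC_nat !exprD !exprSr.
  by ring.
have ltl' : (l < l')%N by lia.
by do !apply: reducibleD; try apply: reducibleZ; exact: IH.
Qed.

Lemma in_gens_alg_reducible f : in_gens_alg f -> reducible f.
Proof.
move=> [Q ->]; rewrite comp_mpolyEX.
elim/big_ind: _ => [||m _].
- by exists 0; [move=> m; rewrite msupp0 | rewrite linear0].
- exact: reducibleD.
apply: reducibleZ; rewrite comp_mpolyX big_ord4.
exact: reducible_mon.
Qed.

(** In a reduced expression [Q] of [a0 F * f], the part [Q0] free of the first variable evaluates to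
    a multiple of [a0]. Were it nonzero, its lead monomial would be prime to [a0]; so [Q0 = 0] and
    [a0] cancels. *)
Lemma in_gens_alg_div_a0 (f : {mpoly F[3]}) : in_gens_alg (a0 F * f) -> in_gens_alg f.
Proof.
move=> /in_gens_alg_reducible[Q redQ fE].
pose Q0 := \sum_(m <- msupp Q | m k0 == 0%N) Q@_m *: 'X_[m].
(* The truncated subtraction is exact, since [m k0 != 0]. *)
pose Q1 := \sum_(m <- msupp Q | m k0 != 0%N) Q@_m *: 'X_[(m - U_(k0))%MM].
have QE : Q = Q0 + 'X_k0 * Q1.
  rewrite {1}[Q]mpolyE (bigID (fun m : 'X_{1..4} => m k0 == 0%N)) /=.
  congr (_ + _); rewrite mulr_sumr; apply: eq_bigr => m m0.
  rewrite -scalerAr -mpolyXD addmC submK //; apply/mnm_lepP => j.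
  by rewrite mnm1E; case: eqP => // <-; rewrite lt0n.
have Q0_supp m : m \in msupp Q0 -> m \in msupp Q /\ m k0 = 0%N.
  move=> mQ0; have: m \in [seq m : 'X_{1..4} <- msupp Q | m k0 == 0%N].
    move: mQ0; rewrite /Q0 -big_filter => /msupp_sum_le.
    case/flatten_mapP => m' m'Q /msuppZ_le /mem_msuppXP <-.
    by move: m'Q; rewrite filter_predT.
  by rewrite mem_filter => /andP[/eqP].
have compX0 : 'X_k0 \mPo gens = a0 F by rewrite comp_mpolyXU.
have fE0 : Q0 \mPo gens = a0 F * (f - (Q1 \mPo gens)).
  by rewrite mulrBr fE {1}QE rmorphD rmorphM /= compX0 addrK.
have [Q0E|/reduced_lead [|m /Q0_supp [_ m0] [ms _]]] := eqVneq Q0 0.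
- exists Q1; apply/eqP; rewrite -subr_eq0; move/eqP: fE0.
  by rewrite Q0E linear0 eq_sym mulf_eq0 (negPf a0_neq0).
- by move=> m /Q0_supp[/redQ].
have := ms; rewrite fE0 mulrC (perm_mem (msuppMX _ _)).
case/mapP => k _ /(congr1 (fun m : 'X_{1..3} => m i0)).
by rewrite mon_lead0 m0 mnmDE mnm1E.
Qed.

End Generators.

(** * Invariants *)

(** Reduces the compatibilities between the substitutions below to constants and variables. *)
Lemma eq_rmorph_mpoly (n : nat) (R : comNzRingType) (S : comNzRingType)
    (f g : {rmorphism {mpoly R[n]} -> S}) :
  (forall c, f c%:MP = g c%:MP) -> (forall i, f 'X_i = g 'X_i) -> f =1 g.
Proof.
move=> eqC eqX p; rewrite [p]mpolyE !rmorph_sum; apply: eq_bigr => m _.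
rewrite -mul_mpolyC !rmorphM eqC mpolyXE_id !rmorph_prod; congr (_ * _).
by apply: eq_bigr => i _; rewrite !rmorphXn /= eqX.
Qed.

Section Invariants.
Variables (F : fieldType) (K : finFieldType) (iota : {rmorphism K -> F}).
Let q := #|K|.
Hypothesis pcharq : [pchar F].-nat q.
Hypothesis oddq : odd q.

Lemma invariantPP f :
  reflect (forall c, f \mPo sigma (iota c) = f) (f \in invariantP iota).
Proof. by rewrite unfold_in; apply: (iffP forallP) => H c; apply/eqP. Qed.

Lemma comp_a0 c : a0 F \mPo sigma c = a0 F.
Proof. by rewrite comp_mpolyXU. Qed.

Lemma comp_a1 c : a1 F \mPo sigma c = a1 F + c *: a0 F.
Proof. by rewrite comp_mpolyXU. Qed.

Lemma comp_a2 c : a2 F \mPo sigma c = a2 F + (2 * c) *: a1 F + c ^+ 2 *: a0 F.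
Proof. by rewrite comp_mpolyXU. Qed.

Lemma gens_invariant i : tnth (gens iota) i \in invariantP iota.
Proof.
apply/invariantPP => c; move: i; apply: ord4P; rewrite /tnth /=.
- exact: comp_a0.
- rewrite /Delta rmorphB rmorphXn rmorphM /= comp_a0 comp_a1 comp_a2.
  by rewrite -!mul_mpolyC mpolyCM rmorphXn /= mpolyC_nat; ring.
(* The action permutes the factors: the one at [d - c] is sent to the one at [d]. The same holds for
   [gamma]. *)
- rewrite /beta rmorph_prod (reindex_inj (addIr (- c))) /=.
  apply: eq_bigr => d _; rewrite rmorphD /= linearZ /= comp_a0 comp_a1.
  by rewrite rmorphB -!mul_mpolyC mpolyCB; ring.
- rewrite /gamma rmorph_prod (reindex_inj (addIr (- c))) /=.
  apply: eq_bigr => d _; rewrite !subr0 !rmorphD /= !linearZ /= comp_a0 comp_a1 comp_a2.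
  by rewrite rmorphN -!mul_mpolyC !rmorphXn /= !mpolyCM !mpolyCB !mpolyC_nat; ring.
Qed.

Lemma in_gens_algD (f g : {mpoly F[3]}) : in_gens_alg iota f -> in_gens_alg iota g -> in_gens_alg iota (f + g).
Proof. by move=> [Q ->] [R ->]; exists (Q + R); rewrite rmorphD. Qed.

Lemma in_gens_alg_sum (I : Type) (r : seq I) (P : pred I) (G : I -> {mpoly F[3]}) :
  (forall i, P i -> in_gens_alg iota (G i)) -> in_gens_alg iota (\sum_(i <- r | P i) G i).
Proof.
move=> H; elim/big_ind: _ => //; first by exists 0; rewrite rmorph0.
exact: in_gens_algD.
Qed.

(** Variables go to linear forms, so degrees are kept; hence homogeneous components of an invariant
    are invariant. *)
Lemma pihomog_comp_sigma (c : F) d (f : {mpoly F[3]}) :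
  pihomog mdeg d (f \mPo sigma c) = pihomog mdeg d f \mPo sigma c.
Proof.
have homX m : 'X_[m] \mPo sigma c \is (mdeg m).-homog.
  rewrite comp_mpolyX big_ord3 mdeg3.
  have homXi i : 'X_i \is [in F[3], 1.-homog] by rewrite dhomogX /= mdeg1.
  have homP k (g : {mpoly F[3]}) : g \is 1.-homog -> g ^+ k \is k.-homog.
    by move=> /(dhomogMn k); rewrite mul1n.
  by rewrite !dhomogM //=; apply: homP; rewrite /tnth /=;
    do ?[exact: homXi | apply: rpredD | apply: rpredZ].
elim/mpolyind: f; first by rewrite rmorph0 !pihomog0 rmorph0.
move=> k m p _ _ IH; rewrite !linearP /= {}IH.
congr (k *: _ + _); case: (eqVneq (mdeg m) d) => [<-|ne].
  by rewrite pihomogX eqxx pihomog_dE.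
by rewrite (pihomog_ne0 ne (homX m)) pihomogX (negPf ne) linear0.
Qed.

Lemma comp_a0_scale d (f : {mpoly F[3]}) : f \is d.-homog ->
  f \mPo [tuple a0 F * 'X_i | i < 3] = a0 F ^+ d * f.
Proof.
move=> homf; rewrite comp_mpolyE [X in _ = _ * X]mpolyE mulr_sumr.
rewrite !big_seq; apply: eq_bigr => m /(dhomog_mf homf) /= <-.
rewrite -scalerAr mdegE mpolyXE_id -prodrXr -big_split /=; congr (_ *: _).
by apply: eq_bigr => i _; rewrite tnth_mktuple exprMn.
Qed.

(** * Passage to translation-invariant polynomials over F[s, D], and back *)

Let C := {mpoly F[2]}.
Let s : C := 'X_ord0.
Let D : C := 'X_ord_max.
Let cst : {rmorphism F -> {poly C}} := polyC \o @mpolyC 2 F.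

(** At s = [a0], D = [Delta], T = [a1], each entry becomes [a0] times the corresponding variable,
    because [a1 ^+ 2 - Delta] is [a0 * a2]. *)
Let para (i : 'I_3) : {poly C} :=
  nth 0 [:: (s ^+ 2)%:P; s%:P * 'X; 'X ^+ 2 - D%:P] i.

Let lift : {rmorphism {mpoly F[3]} -> {poly C}} := mmap cst para.

Let liftC c : lift c%:MP = (c%:MP)%:P.
Proof. exact: mmapC. Qed.

Let liftX i : lift 'X_i = para i.
Proof. by rewrite /lift /= mmapX mmap1U. Qed.

Let phi : {rmorphism K -> C} := @mpolyC 2 F \o iota.

(** Replacing T by T + cs acts on s^2, sT, T^2 - D exactly as sigma_c acts on [a0], [a1], [a2]. *)
Let lift_translate c f :
  lift f \Po ('X + (phi c * s)%:P) = lift (f \mPo sigma (iota c)).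
Proof.
pose t : {rmorphism {poly C} -> {poly C}} := comp_poly ('X + (phi c * s)%:P).
pose S : {rmorphism _ -> {mpoly F[3]}} := comp_mpoly (sigma (iota c)).
apply: (@eq_rmorph_mpoly _ _ _ (t \o lift) (lift \o S)) => [x|].
  by rewrite /= liftC comp_mpolyC comp_polyC liftC.
apply: ord3P; rewrite /= liftX.
- by rewrite comp_a0 liftX /para /= comp_polyC.
- rewrite comp_a1 rmorphD -mul_mpolyC rmorphM !liftX liftC /para /=.
  by rewrite rmorphM /= comp_polyX comp_polyC polyCM rmorphXn /phi /=; ring.
- rewrite comp_a2 !rmorphD -!mul_mpolyC !rmorphM !liftX !liftC /para /=.
  rewrite comp_polyX rmorphN /= comp_polyC mpolyC_nat polyC_natr rmorphXn /=.
  by ring.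
Qed.

Let psi : {rmorphism C -> {mpoly F[3]}} := comp_mpoly [tuple a0 F; Delta F].

Let eval P := (map_poly psi P).[a1 F].

Let eval_lift f : eval (lift f) = f \mPo [tuple a0 F * 'X_i | i < 3].
Proof.
pose e : {rmorphism {poly C} -> {mpoly F[3]}} :=
  horner_eval (a1 F) \o map_poly psi.
apply: (@eq_rmorph_mpoly _ _ _ (e \o lift) (comp_mpoly [tuple a0 F * 'X_i | i < 3])).
  by move=> x; rewrite /= liftC /horner_eval map_polyC hornerC /= !comp_mpolyC.
have es : e s%:P = a0 F.
  by rewrite /= map_polyC /horner_eval hornerC /= comp_mpolyXU.
have eD : e D%:P = Delta F.
  by rewrite /= map_polyC /horner_eval hornerC /= comp_mpolyXU.
have eX : e 'X = a1 F by rewrite /= map_polyX /horner_eval hornerX.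
move=> i; rewrite [RHS]comp_mpolyXU -tnth_nth tnth_mktuple -[LHS]/(e (lift _)).
rewrite liftX; clearbody e; move: i; apply: ord3P; rewrite /para /=.
- by rewrite polyC_exp rmorphXn es expr2.
- by rewrite rmorphM es eX.
- by rewrite rmorphB rmorphXn eX eD /Delta /a2; ring.
Qed.

Let eval_comp_additive Q : in_gens_alg iota (eval (Q \Po additive_poly K s)).
Proof.
have psis : s \mPo [tuple a0 F; Delta F] = a0 F by rewrite comp_mpolyXU.
rewrite /eval map_comp_poly horner_comp.
have -> : (map_poly psi (additive_poly K s)).[a1 F] = beta iota.
  rewrite betaE rmorphB /= map_polyXn map_polyZ map_polyX rmorphXn /= psis.
  by rewrite !hornerE.
pose chi : {rmorphism C -> {mpoly F[4]}} :=
  comp_mpoly [tuple 'X_k0 : {mpoly F[4]}; 'X_k1].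
pose G : {rmorphism {mpoly F[4]} -> {mpoly F[3]}} := comp_mpoly (gens iota).
(* The coefficients of [Q] are polynomials in s and D, which become the variables of [a0] and
   [Delta]; the argument becomes that of [beta]. *)
exists (map_poly chi Q).['X_k2].
have -> : beta iota = G 'X_k2 by rewrite /G /= comp_mpolyXU.
rewrite -[RHS]/(G _) -horner_map -map_poly_comp /=; congr (_.[_]).
apply: eq_map_poly; apply: (@eq_rmorph_mpoly _ _ _ psi (G \o chi)) => [x|i].
  by rewrite /= !comp_mpolyC.
rewrite /= !comp_mpolyXU; case: i => [[|[|//]] lti] /=; by rewrite comp_mpolyXU.
Qed.

Lemma invariant_in_alg f : f \in invariantP iota -> in_gens_alg iota f.
Proof.
move=> /invariantPP invf; rewrite (pihomog_partitionE (leqnn (mmeasure mdeg f))).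
apply: in_gens_alg_sum => d _; set g := pihomog _ _ _.
have homg : g \is d.-homog by exact: pihomogP.
have invg c : g \mPo sigma (iota c) = g by rewrite -pihomog_comp_sigma invf.
have s0 : s != 0 by rewrite -msupp_eq0 msuppX.
have pcharC : [pchar C].-nat q.
  by apply: sub_in_pnat pcharq => p _; exact: (rmorph_pchar (@mpolyC 2 F)).
have [|Q QE] := translation_invariant_poly (phi := phi) s0 pcharC (P := lift g).
  by move=> c; rewrite lift_translate invg.
(* This puts [a0 ^+ d * g] in the algebra; the factors [a0] are then cancelled one by one. *)
have := eval_comp_additive Q; rewrite -QE eval_lift (comp_a0_scale homg).
elim: (val d) => [|n IH]; first by rewrite mul1r.
by rewrite exprS -mulrA => /(in_gens_alg_div_a0 oddq pcharq).
Qed.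

End Invariants.

Unset Implicit Arguments.

Theorem theorem2p5 (p n q : nat) (F : fieldType) (K : finFieldType)
    (iota : {rmorphism K -> F}) :
  prime p -> (2 < p)%N -> q = (p ^ n)%N -> #|K| = q -> p \in [pchar F] ->
  let B : 'I_4 -> {mpoly F[3]} :=
    fun i => tnth [tuple a0 F; Delta F; beta iota; gamma iota 0] i in
  (* B generates F[V]^P as an F-algebra *)
  ((forall i, B i \in invariantP iota) /\
   (forall f, f \in invariantP iota ->
      exists Qp : {mpoly F[4]}, f = Qp \mPo [tuple B i | i < 4])) /\
  (* B is a SAGBI basis of F[V]^P for grevlex with a0 < a1 < a2 *)
  grevlex_SAGBI (invariantP iota) B.
Proof.
move=> p_pr p_gt2 qE cardK pF B.
have pcharq : [pchar F].-nat #|K|.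
  by rewrite cardK qE pnatX (eq_pnat _ (pcharf_eq pF)) pnat_id.
have oddq : odd #|K|.
  by case: (even_prime p_pr) p_gt2 => [-> //|oddp _]; rewrite cardK qE oddX oddp orbT.
have invB i : B i \in invariantP iota by exact: gens_invariant.
have BE : [tuple B i | i < 4] = gens iota.
  by apply: eq_from_tnth => i; rewrite tnth_mktuple.
have gen f : f \in invariantP iota -> in_gens_alg iota f.
  exact: invariant_in_alg.
split; first by split=> // f /gen; rewrite BE.
split=> // f /gen /(in_gens_alg_reducible oddq pcharq) [Q redQ ->] f0 m lead_m.
have Q0 : Q != 0 by apply: contraNneq f0 => ->; rewrite rmorph0.
have [k _ lead_k] := reduced_lead iota oddq redQ Q0.
(* The lead monomial of the invariant is that of a single reduced product, whose exponent vector is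
   [k]. *)
exists (gens_lead #|K|), k; split=> [i|j].
  exact/monic_lead_grevlex/monic_lead_gens.
by rewrite (grevlex_lead_uniq lead_m lead_k) mon_leadE.
Qed.
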